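(* Let $f:S_n\to\mathbb{R}$ be a function of the form $$f(\sigma)=\sum_{i,j=1}^n b_{\sigma(i)\sigma(j)}\,a_{ij}$$ for some real $n\times n$ matrices $A=(a_{ij})$, $B=(b_{ij})$, or, more generally, of the form $$f(\sigma)=\sum_{i,j=1}^n c^{ij}_{\sigma(i)\sigma(j)}$$ for some array $\{c^{ij}_{kl}:1\le i,j,k,l\le n\}$ of $n^4$ real numbers. Let $\overline f=\frac1{n!}\sum_{\sigma\in S_n}f(\sigma)$, let $f_0=f-\overline f$, and let $\tau\in S_n$ satisfy $f_0(\tau)=\max_{\sigma\in S_n}f_0(\sigma)$. Let $k$ be an integer with $3\le k\le n-5$, let $0<\gamma<1$, and let $$\beta(n,k)=\frac{k-2}{n^2-nk+k-2}.$$ Then the probability that a uniformly random permutation $\sigma\in S_n$ satisfies $$f_0(\sigma)\ge\gamma\,\beta(n,k)\,f_0(\tau)$$ is at least $$\frac{(1-\gamma)\,\beta(n,k)}{5\,k!}.$$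
   Context: $S_n$ is the group of permutations of $\{1,\dots,n\}$. *)

(* Defs.v *)
From HB Require Import structures.
From mathcomp Require Import all_boot all_order all_fingroup all_algebra.
From mathcomp Require Import reals.

Set Implicit Arguments.
Unset Strict Implicit.
Unset Printing Implicit Defensive.

Import Order.TTheory GRing.Theory Num.Theory.
Local Open Scope ring_scope.

Definition qap_objective (R : realType) (n : nat) (A B : 'M[R]_n)
    (sigma : 'S_n) : R :=
  \sum_(i < n) \sum_(j < n) B (sigma i) (sigma j) * A i j.

(* [c i j k l] is the entry with upper indices i, j and lower indices k, l. *)
Definition gen_qap_objective (R : realType) (n : nat)
    (c : 'I_n -> 'I_n -> 'I_n -> 'I_n -> R) (sigma : 'S_n) : R :=
  \sum_(i < n) \sum_(j < n) c i j (sigma i) (sigma j).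

Definition is_qap (R : realType) (n : nat) (f : 'S_n -> R) : Prop :=
  exists A B : 'M[R]_n, forall sigma, f sigma = qap_objective A B sigma.

Definition is_gen_qap (R : realType) (n : nat) (f : 'S_n -> R) : Prop :=
  exists c : 'I_n -> 'I_n -> 'I_n -> 'I_n -> R,
    forall sigma, f sigma = gen_qap_objective c sigma.

Definition perm_mean (R : realType) (n : nat) (f : 'S_n -> R) : R :=
  (n`!%:R)^-1 * \sum_(sigma : 'S_n) f sigma.

Definition centered (R : realType) (n : nat) (f : 'S_n -> R)
    (sigma : 'S_n) : R :=
  f sigma - perm_mean f.

Definition beta_nk (R : realType) (n k : nat) : R :=
  (k%:R - 2) / (n%:R ^+ 2 - n%:R * k%:R + k%:R - 2).

Definition unif_prob (R : realType) (n : nat) (E : {set 'S_n}) : R :=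
  #|E|%:R / #|{: 'S_n}|%:R.

(* Main.v *)
(* Composing with [tau], assume that [tau = 1].  Averaging [f] over the
   conjugates of its argument leaves its mean and its value at [1] unchanged and
   produces a class function [g], which is a combination [a + b p + d p^2 + e r]
   of the number [p] of fixed points and of the number [r] of points in 2-cycles,
   because a 4-tuple [(i, j, s i, s j)] matters only through its pattern of
   coincidences.  Over all permutations [p], [p^2], [r] have means [1], [2], [1],
   so that [p * (p - k)] has the negative mean [2 - k]; hence, were [r] equal to
   its mean, [g - mean] could not be below [beta * (g - mean)(1)] both at [p = 0]
   and at [p = k].  The distribution of [r] on each of these two layers can be
   reweighted so as to neutralise the term [e r], whatever the sign of [e], while
   keeping a [1 / (5 p!)] fraction of the group.  A Markov-type inequality for
   the weighted mean of [f], which is bounded by [f 1], concludes. *)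

Require Import Defs.
From HB Require Import structures.
From mathcomp Require Import all_boot all_order all_fingroup all_algebra.
From mathcomp Require Import reals.
From mathcomp Require Import ring lra zify.

Set Implicit Arguments.
Unset Strict Implicit.
Unset Printing Implicit Defensive.

Import Order.TTheory GRing.Theory Num.Theory.
Local Open Scope ring_scope.

Section PermutationCounts.
Local Open Scope nat_scope.

(** * Permutations with a prescribed support *)

Section SupportCounting.
Variable T : finType.
Implicit Types (s : {perm T}) (A : {set T}) (x y : T).

Definition supp s : {set T} := [set x | s x != x].

Definition swapped s : {set T} := [set x | (s x != x) && (s (s x) == x)].

Lemma card_perm_lmul (P : pred {perm T}) t :
  #|[set s | P s]| = #|[set s | P (t * s)%g]|.
Proof.
rewrite -(card_preimset [set s | P s] (mulgI t)).
by apply: eq_card => s; rewrite !inE.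
Qed.

Lemma card_perm_rmul (P : pred {perm T}) t :
  #|[set s | P s]| = #|[set s | P (s * t)%g]|.
Proof.
rewrite -(card_preimset [set s | P s] (mulIg t)).
by apply: eq_card => s; rewrite !inE.
Qed.

Lemma card_perm_fix2 x y : x != y ->
  #|[set s : {perm T} | (s x == x) && (s y == y)]| = (#|T| - 2)`!.
Proof.
move=> xy; have -> : (#|T| - 2)%N = #|~: [set x; y]|.
  by rewrite -(cardsC [set x; y]) cards2 xy addKn.
rewrite -card_perm; apply: eq_card => s; rewrite !inE.
apply/andP/subsetP => [[/eqP sx /eqP sy] z|sub].
  by rewrite !inE; apply: contra => /orP[] /eqP ->; rewrite ?sx ?sy.
by split; apply: contraT => /sub; rewrite !inE eqxx ?orbT.
Qed.

Lemma card_perm_fix1 x :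
  #|[set s : {perm T} | s x == x]| = (#|T| - 1)`!.
Proof.
have -> : (#|T| - 1)%N = #|~: [set x]| by rewrite cardsC1 subn1.
rewrite -card_perm; apply: eq_card => s; rewrite !inE.
apply/eqP/subsetP => [sx z|sub].
  by rewrite !inE; apply: contra => /eqP ->; rewrite sx.
by apply/eqP; apply: contraT => /sub; rewrite !inE eqxx.
Qed.

Lemma card_perm_swap2 x y : x != y ->
  #|[set s : {perm T} | (s x == y) && (s y == x)]| = (#|T| - 2)`!.
Proof.
move=> xy; rewrite [LHS](card_perm_lmul _ (tperm x y)) -(card_perm_fix2 xy).
by apply: eq_card => s; rewrite !inE !permM tpermL tpermR andbC.
Qed.

(** Composing with the transposition [tperm x y] deletes the 2-cycle through [x] and [y] and changes
    nothing elsewhere. *)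
Lemma card_supp_swap2 A x y : x != y -> x \in A -> y \in A ->
  #|[set s : {perm T} | [&& supp s == A, s x == y & s y == x]]|
  = #|[set s | supp s == A :\ x :\ y]|.
Proof.
move=> xy xA yA; rewrite [LHS](card_perm_lmul _ (tperm x y)).
apply: eq_card => s; rewrite !inE !permM tpermL tpermR.
have yx : y != x by rewrite eq_sym.
apply/and3P/eqP => [[/eqP sA /eqP sy /eqP sx]|sA].
  apply/setP => z; move/setP/(_ z): sA; rewrite !inE permM.
  by case: tpermP => [->|->|/eqP zx /eqP zy] <-; rewrite ?sx ?sy ?eqxx ?andbF ?zx ?zy.
have sx : s x = x.
  by move/setP/(_ x): sA; rewrite !inE eqxx andbF => /negbFE/eqP.
have sy : s y = y by move/setP/(_ y): sA; rewrite !inE eqxx => /negbFE/eqP.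
rewrite sx sy !eqxx; split=> //; apply/eqP/setP => z.
move/setP/(_ z): sA; rewrite !inE permM.
case: tpermP => [->|->|/eqP zx /eqP zy] E; rewrite ?sx ?sy ?xA ?yA //.
by rewrite E zy zx.
Qed.

(* Removing [x] from its cycle leaves a permutation supported on [A :\ x], or,
   when the cycle was [(x y)], on [A :\ x :\ y]. *)
Lemma card_supp_image A x y : x != y -> x \in A -> y \in A ->
  #|[set s : {perm T} | (supp s == A) && (s x == y)]|
  = #|[set s | supp s == A :\ x]| + #|[set s | supp s == A :\ x :\ y]|.
Proof.
move=> xy xA yA; have yx : y != x by rewrite eq_sym.
(* Right multiplication by the transposition makes [x] a fixed point and sends the former preimage
   of [x] straight to [y]. The two target supports differ at [y], so the union below is disjoint. *)
rewrite [LHS](card_perm_rmul _ (tperm x y)).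
rewrite -(cardsUI [set s | supp s == A :\ x]).
rewrite [X in _ + #|pred_of_set X|](_ : _ = set0); last first.
  apply/setP => s; rewrite !inE; apply/negP => /andP[/eqP-> /eqP/setP/(_ y)].
  by rewrite !inE eqxx yx yA.
rewrite cards0 addn0; apply: eq_card => s; rewrite !inE permM.
have tE z : z != x -> s x = x -> (tperm x y (s z) == z) = (z != y) && (s z == z).
  move=> zx sx; have szx : s z != x by rewrite -{1}sx (inj_eq perm_inj).
  case: tpermP => [E|E|_ /eqP szy]; first by rewrite E eqxx in szx.
    rewrite E; have [->|] := eqVneq z y; first by rewrite (negPf xy).
    by move=> _; rewrite [x == z]eq_sym (negPf zx).
  by have [E|] := eqVneq z y; rewrite //= {2}E (negPf szy).
apply/andP/orP => [[/eqP sA E]|sA].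
  have sx : s x = x.
    by apply: (@perm_inj _ (tperm x y)); rewrite (eqP E) tpermL.
  have sAE z : z != x -> z != y -> (s z != z) = (z \in A).
    by move=> zx zy; rewrite -sA inE permM tE // zy.
  have [sy|sy] := eqVneq (s y) y; [right|left]; apply/eqP/setP => z; rewrite !inE.
    have [->|zy] := eqVneq z y; first by rewrite sy eqxx.
    have [->|zx] := eqVneq z x; first by rewrite sx eqxx.
    by rewrite sAE.
  have [->|zx] := eqVneq z x; first by rewrite sx eqxx.
  have [->|zy] := eqVneq z y; first by rewrite sy yA.
  by rewrite sAE.
have sx : s x = x.
  by case: sA => /eqP/setP/(_ x); rewrite !inE eqxx ?andbF => /negbFE/eqP.
rewrite sx tpermL eqxx; split=> //; apply/eqP/setP => z; rewrite inE permM.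
have [->|zx] := eqVneq z x; first by rewrite sx tpermL xA yx.
rewrite tE // negb_and negbK; have [->|zy] := eqVneq z y; first by rewrite yA.
by case: sA => /eqP/setP/(_ z); rewrite !inE zx ?zy.
Qed.

End SupportCounting.

(** * Derangement numbers, defined by the recurrence that removing a point from its cycle
    produces *)

Fixpoint subfactorial n :=
  match n with
  | 0 => 1
  | n'.+1 => match n' with
             | 0 => 0
             | n''.+1 => n' * (subfactorial n' + subfactorial n'')
             end
  end.

Lemma subfactorialSS n : subfactorial n.+2 = n.+1 * (subfactorial n.+1 + subfactorial n).
Proof. by []. Qed.

(** Induction on the size of [A]: fix [x] in [A] and split according to its image [y]. Each [y] in
    [A :\ x] contributes the same count by [card_supp_image], which reproduces the recurrence. *)
Lemma card_supp (T : finType) (A : {set T}) :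
  #|[set s : {perm T} | supp s == A]| = subfactorial #|A|.
Proof.
have [n] := ubnP #|A|; elim: n A => // n IH A.
have [->|[x xA]] := set_0Vmem A => [_|].
  rewrite cards0 /= -[RHS](cards1 (1%g : {perm T})); apply: eq_card => s; rewrite !inE.
  apply/eqP/eqP => [/setP s0|->]; last by apply/setP => x; rewrite !inE perm1 eqxx.
  by apply/permP => x; move: (s0 x); rewrite !inE perm1 => /negbFE/eqP.
have A1 := cardsD1 x A; rewrite xA in A1; rewrite ltnS A1 => An.
have -> : #|[set s | supp s == A]| =
    \sum_(y in A :\ x) #|[set s : {perm T} | (supp s == A) && (s x == y)]|.
  rewrite -sum1dep_card (partition_big (fun s : {perm T} => s x) (mem (A :\ x))) /=.
    by apply: eq_bigr => y _; rewrite sum1dep_card.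
  move=> s /eqP sA; rewrite !inE -sA inE.
  have sx : s x != x by move: xA; rewrite -sA inE.
  by rewrite (inj_eq perm_inj) sx.
rewrite (eq_bigr (fun=> subfactorial #|A :\ x| + subfactorial (#|A :\ x| - 1))); last first.
  move=> y; rewrite !inE => /andP[yx yA]; rewrite card_supp_image 1?eq_sym //.
  rewrite !IH //.
    by congr (_ + subfactorial _); rewrite (cardsD1 y (A :\ x)) !inE yx yA addKn.
  by apply: leq_trans An; rewrite ltnS subset_leq_card // subsetDl.
rewrite sum_nat_const; case: #|A :\ x| => [|m] //.
by rewrite subSS subn0.
Qed.

(** By the recurrence, the proportion of derangements on [n + 2] points is a convex combination of
    the two preceding proportions, so it stays between the values 1/3 at [n = 3] and 3/8 at
    [n = 4]. *)
Lemma subfactorial_bounds n : 3 <= n ->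
  (n`! <= 3 * subfactorial n) && (8 * subfactorial n <= 3 * n`!).
Proof.
case: n => [|[|[|n]]] // _.
pose P k := (k`! <= 3 * subfactorial k) && (8 * subfactorial k <= 3 * k`!).
suff H m : P m.+3 && P m.+4 by have /andP[] := H n.
elim: m => [//|m /andP[H3 H4]]; rewrite H4 /=.
move: H3 H4; rewrite /P (subfactorialSS m.+3) !(factS m.+4) (factS m.+3).
move: (subfactorial m.+4) (subfactorial m.+3) (m.+3)`! => a b c; nia.
Qed.

(** * Points in 2-cycles *)

Section TwoCycles.
Variable T : finType.
Implicit Types (s : {perm T}) (A : {set T}) (x y : T).

Lemma card_swapped s :
  #|swapped s| = \sum_x \sum_(y | y != x) ((s x == y) && (s y == x)).
Proof.
rewrite -sum1dep_card big_mkcond /=; apply: eq_bigr => x _.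
have [sx|sx] := eqVneq (s x) x.
  by rewrite big1 //= => y yx; rewrite sx eq_sym (negPf yx).
rewrite (bigD1 (s x)) //= eqxx big1 ?addn0 //=.
by move=> y /andP[_ /negPf]; rewrite eq_sym => ->.
Qed.

Lemma card_card_supp m :
  #|[set s : {perm T} | #|supp s| == m]| = 'C(#|T|, m) * subfactorial m.
Proof.
rewrite -card_draws -sum1dep_card.
rewrite (partition_big (@supp T) (mem [set A : {set T} | #|A| == m])) /=; last first.
  by move=> s; rewrite inE.
rewrite -sum_nat_const; apply: eq_bigr => A; rewrite inE => /eqP Am.
rewrite -Am -card_supp -sum1dep_card; apply: eq_bigl => s.
by case: (eqVneq (supp s) A) => [->|]; rewrite ?eqxx ?andbF.
Qed.

(** Swapped points are counted as ordered pairs [(x, y)] forming a 2-cycle inside the support; what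
    remains is a derangement of [m - 2] points. Truncated subtraction is harmless, since
    [m * (m - 1)] vanishes for [m < 2]. *)
Lemma sum_card_swapped m :
  \sum_(s : {perm T} | #|supp s| == m) #|swapped s|
  = 'C(#|T|, m) * (m * (m - 1) * subfactorial (m - 2)).
Proof.
rewrite -card_draws.
rewrite (partition_big (@supp T) (mem [set A : {set T} | #|A| == m])) /=; last first.
  by move=> s; rewrite inE.
rewrite -sum_nat_const; apply: eq_bigr => A; rewrite inE => /eqP Am.
transitivity (\sum_(x in A) \sum_(y in A :\ x)
    #|[set s : {perm T} | [&& supp s == A, s x == y & s y == x]]|).
  rewrite (eq_bigl (fun s => supp s == A)); last first.
    by move=> s; case: (eqVneq (supp s) A) => [->|]; rewrite ?Am ?eqxx ?andbF.
  under eq_bigr do rewrite card_swapped.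
  rewrite exchange_big [RHS]big_mkcond /=; apply: eq_bigr => x _.
  rewrite exchange_big; case: ifPn => xA.
    rewrite big_mkcond [RHS]big_mkcond; apply: eq_bigr => y _; rewrite !inE.
    case: ifP => yx //=; case: ifPn => yA.
      by rewrite -sum1dep_card big_mkcondr; apply: eq_bigr => s _; case: andP.
    rewrite big1 // => s /eqP sA; move: yA; rewrite -sA inE negbK => /eqP sy.
    by rewrite sy (negPf yx) andbF.
  rewrite big1 // => y yx; rewrite big1 // => s /eqP sA.
  by move: xA; rewrite -sA inE negbK => /eqP ->; rewrite eq_sym (negPf yx).
rewrite (eq_bigr (fun=> (m - 1) * subfactorial (m - 2))).
  by rewrite sum_nat_const Am mulnA.
move=> x xA; have A1 : #|A :\ x| = m - 1 by rewrite -Am (cardsD1 x A) xA addKn.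
rewrite (eq_bigr (fun=> subfactorial (m - 2))); first by rewrite sum_nat_const A1.
move=> y; rewrite !inE => /andP[yx yA].
rewrite card_supp_swap2 1?eq_sym // card_supp; congr subfactorial.
by move: (cardsD1 y (A :\ x)); rewrite A1 !inE yx yA /=; lia.
Qed.

End TwoCycles.

(** * Layers by number of fixed points, and moments over the whole group *)

Section Moments.
Variable T : finType.
Implicit Types (s : {perm T}) (A : {set T}) (x y : T).

Definition fixn s := #|[set x | s x == x]|.

Lemma fixnE s : fixn s = \sum_x (s x == x).
Proof. by rewrite /fixn -sum1dep_card big_mkcond; apply: eq_bigr => x _; case: eqP. Qed.

Lemma fixn_supp s : fixn s + #|supp s| = #|T|.
Proof.
rewrite -(cardsC (supp s)) addnC; congr (_ + _).
by apply: eq_card => x; rewrite !inE negbK.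
Qed.

Lemma card_sum_perm (P : pred {perm T}) : #|[set s | P s]| = \sum_s P s.
Proof. by rewrite -sum1dep_card big_mkcond; apply: eq_bigr => s _; case: (P s). Qed.

Lemma card_fixn j : j <= #|T| ->
  #|[set s | fixn s == j]| = 'C(#|T|, j) * subfactorial (#|T| - j).
Proof.
move=> jT; rewrite -bin_sub // -card_card_supp; apply: eq_card => s; rewrite !inE.
by move: (fixn_supp s); lia.
Qed.

Lemma sum_fixn_swapped j : j <= #|T| ->
  \sum_(s | fixn s == j) #|swapped s| =
  'C(#|T|, j) * ((#|T| - j) * (#|T| - j - 1) * subfactorial (#|T| - j - 2)).
Proof.
move=> jT; rewrite -bin_sub // -sum_card_swapped; apply: eq_bigl => s.
by move: (fixn_supp s); lia.
Qed.

Hypothesis T_gt1 : 1 < #|T|.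

Let factT : #|T|`! = #|T| * (#|T| - 1) * (#|T| - 2)`!.
Proof. by case: #|T| T_gt1 => [|[|m]] // _; rewrite !factS mulnA !subSS !subn0. Qed.

Let factT1 : #|T|`! = #|T| * (#|T| - 1)`!.
Proof. by case: #|T| T_gt1 => [|m] // _; rewrite factS subSS subn0. Qed.

Lemma sum_fixn : \sum_s fixn s = #|T|`!.
Proof.
under eq_bigr do rewrite fixnE.
rewrite exchange_big factT1 /=.
under eq_bigr => x _ do rewrite -card_sum_perm card_perm_fix1.
by rewrite sum_nat_const.
Qed.

(** Counting pairs of fixed points, the diagonal pairs and the pairs of distinct points each
    contribute the factorial of [#|T|]. *)
Lemma sum_fixn_sqr : \sum_s fixn s ^ 2 = 2 * #|T|`!.
Proof.
transitivity (\sum_x \sum_y #|[set s : {perm T} | (s x == x) && (s y == y)]|).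
  under [RHS]eq_bigr => x _ do under eq_bigr => y _ do rewrite card_sum_perm.
  under [RHS]eq_bigr => x _ do rewrite exchange_big.
  rewrite exchange_big; apply: eq_bigr => s _; rewrite fixnE expnS expn1.
  rewrite big_distrl; apply: eq_bigr => x _; rewrite big_distrr.
  by apply: eq_bigr => y _; rewrite -mulnb.
rewrite (eq_bigr (fun=> (#|T| - 1)`! + (#|T| - 1) * (#|T| - 2)`!)).
  by rewrite sum_nat_const mulnDr mulnA -factT -factT1; lia.
move=> x _; rewrite (bigD1 x) //=; congr (_ + _).
  by rewrite -(card_perm_fix1 x); apply: eq_card => s; rewrite !inE andbb.
rewrite (eq_bigr (fun=> (#|T| - 2)`!)).
  by rewrite sum_nat_const cardC1 subn1.
by move=> y yx; rewrite card_perm_fix2 1?eq_sym.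
Qed.

Lemma sum_swapped : \sum_(s : {perm T}) #|swapped s| = #|T|`!.
Proof.
under eq_bigr do rewrite card_swapped.
rewrite exchange_big /= (eq_bigr (fun=> (#|T| - 1) * (#|T| - 2)`!)).
  by rewrite sum_nat_const mulnA -factT.
move=> x _; rewrite exchange_big /= (eq_bigr (fun=> (#|T| - 2)`!)).
  by rewrite sum_nat_const cardC1 subn1.
by move=> y yx; rewrite -card_sum_perm card_perm_swap2 1?eq_sym.
Qed.

End Moments.

Lemma fixn1 (T : finType) : fixn (1%g : {perm T}) = #|T|.
Proof.
rewrite -(fixn_supp 1%g) [supp _](_ : _ = set0) ?cards0 ?addn0 //.
by apply/setP => x; rewrite !inE perm1 eqxx.
Qed.

Lemma swapped1 (T : finType) : #|swapped (1%g : {perm T})| = 0.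
Proof.
by apply/eqP; rewrite cards_eq0; apply/eqP/setP => x; rewrite !inE perm1 eqxx.
Qed.

Lemma fixnJ (T : finType) (s t : {perm T}) : fixn (s ^ t)%g = fixn s.
Proof.
rewrite /fixn -(card_preimset [set x | (s ^ t)%g x == x] (@perm_inj _ t)).
by apply: eq_card => x; rewrite !inE permJ (inj_eq perm_inj).
Qed.

Lemma swappedJ (T : finType) (s t : {perm T}) : #|swapped (s ^ t)%g| = #|swapped s|.
Proof.
rewrite -(card_preimset (swapped (s ^ t)%g) (@perm_inj _ t)).
by apply: eq_card => x; rewrite !inE !permJ !(inj_eq perm_inj).
Qed.

End PermutationCounts.

(** * Conjugation averages as class functions *)

Lemma perm_extend (T : finType) (u : seq (T * T)) :
  {in u &, forall a b, (a.1 == b.1) = (a.2 == b.2)} ->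
  exists t : {perm T}, {in u, forall a, t a.1 = a.2}.
Proof.
elim: u => [|a u IH] Hu; first by exists 1%g.
have [b c bu cu|t Ht] := IH; first by apply: Hu; rewrite inE ?bu ?cu orbT.
(* If [t] realises the tail of the list, the extra transposition corrects the image of [a.1];
   compatibility ensures that it moves none of the other prescribed images. *)
exists (t * tperm (t a.1) a.2)%g => b; rewrite inE permM => /predU1P[->|bu].
  by rewrite tpermL.
have := Hu a b (mem_head _ _); rewrite inE bu orbT => /(_ isT).
rewrite (Ht b bu); have [E1 /esym/eqP E2|ab1 /esym/negbT ab2] := eqVneq a.1 b.1.
  by rewrite E1 (Ht b bu) E2 tpermR.
rewrite tpermD // -(Ht b bu) (inj_eq perm_inj) //.
Qed.

Section ClassAverage.
Variables (R : comRingType) (T : finType) (C : T -> T -> T -> T -> R).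
Hypothesis C_perm : forall (t : {perm T}) i j k l,
  C (t i) (t j) (t k) (t l) = C i j k l.
Hypothesis T_gt3 : (3 < #|T|)%N.

(** Two 4-tuples with the same coincidences lie in one orbit of the diagonal action of the
    permutations, on which [C] is constant. *)
Let C_pattern i j k l i' j' k' l' :
    (i == j) = (i' == j') -> (i == k) = (i' == k') -> (i == l) = (i' == l') ->
    (j == k) = (j' == k') -> (j == l) = (j' == l') -> (k == l) = (k' == l') ->
  C i j k l = C i' j' k' l'.
Proof.
move=> ij ik il jk jl kl.
have [|t Ht] := @perm_extend T [:: (i, i'); (j, j'); (k, k'); (l, l')].
  move=> a b; rewrite !inE => /or4P[] /eqP -> /or4P[] /eqP -> /=;
  by rewrite ?eqxx //; rewrite [LHS]eq_sym [RHS]eq_sym.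
rewrite -(C_perm t) (Ht (i, i')) ?(Ht (j, j')) ?(Ht (k, k')) ?(Ht (l, l')) //;
by rewrite !inE eqxx ?orbT.
Qed.

(** Each term is a polynomial in the indicators of the coincidences among [i], [j], [s i], [s j];
    summing these indicators leaves only the numbers of fixed and of swapped points. *)
Lemma class_average :
  exists a b c d : R, forall s : {perm T},
    \sum_i \sum_j C i j (s i) (s j)
    = a + b * (fixn s)%:R + c * (fixn s)%:R ^+ 2 + d * #|swapped s|%:R.
Proof.
pose o i := enum_val (widen_ord T_gt3 i).
have oE i j : (o i == o j) = (i == j) by rewrite (inj_eq enum_val_inj).
pose P (i j k l : 'I_4) := C (o i) (o j) (o k) (o l).
pose o0 : 'I_4 := @Ordinal 4 0 isT; pose o1 : 'I_4 := @Ordinal 4 1 isT.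
pose o2 : 'I_4 := @Ordinal 4 2 isT; pose o3 : 'I_4 := @Ordinal 4 3 isT.
(* The coefficients come from inclusion-exclusion over the patterns: [A1] to [A3] for [i] or [j]
   fixed, [A4] to [A6] for [s i = j] or [s j = i], and [G0], [G1] to correct the diagonal
   [i = j]. *)
pose A0 := P o0 o1 o2 o3.
pose A1 := P o0 o1 o0 o2 - A0.
pose A2 := P o0 o1 o2 o1 - A0.
pose A3 := P o0 o1 o0 o1 - A0 - A1 - A2.
pose A4 := P o0 o1 o1 o2 - A0.
pose A5 := P o0 o1 o2 o0 - A0.
pose A6 := P o0 o1 o1 o0 - A0 - A4 - A5.
pose G0 := P o0 o0 o1 o1 - A0.
pose G1 := P o0 o0 o0 o0 - P o0 o0 o1 o1 - A1 - A2 - A3 - A4 - A5 - A6.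
pose e (s : {perm T}) x y : R := (s x == y)%:R.
have key (s : {perm T}) i j : C i j (s i) (s j) = A0 + A1 * e s i i + A2 * e s j j
    + A3 * (e s i i * e s j j) + A4 * e s i j + A5 * e s j i
    + A6 * (e s i j * e s j i) + (i == j)%:R * (G0 + G1 * e s i i).
  have CP (i' j' k' l' : 'I_4) : (i == j) = (i' == j') -> (i == s i) = (i' == k') ->
      (i == s j) = (i' == l') -> (j == s i) = (j' == k') ->
      (j == s j) = (j' == l') -> (i == j) = (k' == l') ->
      C i j (s i) (s j) = P i' j' k' l'.
    by move=> *; apply: C_pattern; rewrite ?oE // (inj_eq perm_inj).
  rewrite /e ![s _ == _]eq_sym; have [ij|ij] := eqVneq i j.
    rewrite -ij in CP *; rewrite eqxx in CP.
    have [si|si] := eqVneq i (s i).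
      by rewrite (CP o0 o0 o0 o0) ?eqxx // -?si ?eqxx // /G1 /G0 /=; ring.
    by rewrite (CP o0 o0 o1 o1) ?(negPf si) // /G1 /G0 /=; ring.
  have sij : s i != s j by rewrite (inj_eq perm_inj).
  have [si|si] := eqVneq i (s i).
    have isj : (i == s j) = false by rewrite {1}si (negPf sij).
    have jsi : (j == s i) = false by rewrite -si eq_sym (negPf ij).
    have [sj|sj] := eqVneq j (s j).
      by rewrite (CP o0 o1 o0 o1) ?isj ?jsi -?si -?sj ?eqxx ?(negPf ij) // /A3 /=; ring.
    by rewrite (CP o0 o1 o0 o2) ?isj ?jsi -?si ?eqxx ?(negPf ij) ?(negPf sj) // /A1 /=; ring.
  have [sj|sj] := eqVneq j (s j).
    have isj : (i == s j) = false by rewrite -sj (negPf ij).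
    have jsi : (j == s i) = false by rewrite {1}sj eq_sym (negPf sij).
    by rewrite (CP o0 o1 o2 o1) ?isj ?jsi -?sj ?eqxx ?(negPf ij) ?(negPf si) // /A2 /=; ring.
  have [isj|isj] := eqVneq i (s j); have [jsi|jsi] := eqVneq j (s i).
  - by rewrite (CP o0 o1 o1 o0) -?isj -?jsi ?eqxx ?(negPf ij) // 1?eq_sym ?(negPf ij) // /A6 /=; ring.
  - by rewrite (CP o0 o1 o2 o0) ?(negPf ij) ?(negPf si) ?(negPf sj) ?(negPf isj) ?(negPf jsi) -?isj ?eqxx // /A5 /=; ring.
  - by rewrite (CP o0 o1 o1 o2) ?(negPf ij) ?(negPf si) ?(negPf sj) ?(negPf isj) ?(negPf jsi) -?jsi ?eqxx // /A4 /=; ring.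
  - rewrite (CP o0 o1 o2 o3) ?(negPf ij) ?(negPf si) ?(negPf sj) ?(negPf isj) ?(negPf jsi) //= /A0; ring.
pose N : R := #|T|%:R.
(* [A6] enters the linear coefficient too: its double sum is [p + r], where the diagonal terms
   [i = j] yield the [p]. *)
exists (A0 * N ^+ 2 + A4 * N + A5 * N + G0 * N), (A1 * N + A2 * N + A6 + G1), A3, A6.
move=> s; set p := (fixn s)%:R; set r := (#|swapped s|%:R : R).
have pE : \sum_i e s i i = p by rewrite /p fixnE natr_sum.
have row i : \sum_j e s i j = 1.
  rewrite (bigD1 (s i)) //= /e eqxx big1 ?addr0 // => j.
  by rewrite eq_sym => /negPf ->.
have col j : \sum_i e s i j = 1.
  rewrite (bigD1 ((s^-1)%g j)) //= /e permKV eqxx big1 ?addr0 // => i.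
  by have [<-|] := eqVneq (s i) j; rewrite ?permK ?eqxx // mulr0n.
have prE : \sum_i \sum_j e s i j * e s j i = p + r.
  rewrite -pE /r card_swapped natr_sum -big_split; apply: eq_bigr => i _ /=.
  rewrite (bigD1 i) //= natr_sum; congr (_ + _).
    by rewrite /e; case: (s i == i); rewrite ?mulr1 ?mulr0.
  by apply: eq_bigr => j _; rewrite /e -natrM mulnb.
have diag (F : T -> R) i : \sum_j (i == j)%:R * F i = F i.
  rewrite (bigD1 i) //= eqxx mul1r big1 ?addr0 // => j.
  by rewrite eq_sym => /negPf ->; rewrite mul0r.
have const (x : R) : \sum_(i : T) x = x * N by rewrite sumr_const mulr_natr.
under eq_bigr => i _ do under eq_bigr => j _ do rewrite key.
under eq_bigr => i _.
  rewrite !big_split /= (diag (fun i => G0 + G1 * e s i i)) !const -!mulr_sumr pE row col !mulr1.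
  over.
rewrite !big_split /= -!mulr_suml -!mulr_sumr -!mulr_suml !const prE pE; rewrite /A4 /A5 /G0; ring.
Qed.
End ClassAverage.

(** Relabelling all four indices of [c] by [t] amounts to conjugating [s] by [t], and summing over
    [t] makes the array invariant, so that [class_average] applies. *)
Lemma quadratic_conj_average (R : comRingType) (T : finType)
    (c : T -> T -> T -> T -> R) : (3 < #|T|)%N ->
  exists a b d e : R, forall s : {perm T},
    \sum_(t : {perm T}) \sum_i \sum_j c i j ((s ^ t)%g i) ((s ^ t)%g j)
    = a + b * (fixn s)%:R + d * (fixn s)%:R ^+ 2 + e * #|swapped s|%:R.
Proof.
move=> T3; pose C i j k l := \sum_(t : {perm T}) c (t i) (t j) (t k) (t l).
have [|a [b [d [e abde]]]] := @class_average R T C _ T3.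
  move=> u i j k l; rewrite /C (reindex_inj (mulgI u^-1%g)).
  by apply: eq_bigr => t _; rewrite !permM !permK.
exists a, b, d, e => s; rewrite -abde /C.
under [RHS]eq_bigr => i _ do rewrite exchange_big.
rewrite [RHS]exchange_big; apply: eq_bigr => t _ /=.
rewrite (reindex_inj (@perm_inj _ t)); apply: eq_bigr => i _.
rewrite (reindex_inj (@perm_inj _ t)); apply: eq_bigr => j _.
by rewrite !permJ.
Qed.

(** * Weighted sums and a Markov-type inequality *)

Lemma card_permT (T : finType) : #|{: {perm T}}| = #|T|`!.
Proof.
rewrite -[in RHS]cardsT -card_perm; apply: eq_card => s.
by rewrite !inE; apply/esym/subsetP => x _; rewrite inE.
Qed.

(** A class function gives conjugates equal weight, so [h] may be replaced by its conjugation
    average; the factorial is there because conjugates are summed, not averaged. *)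
Lemma class_weighted_sum (R : comRingType) (T : finType)
    (w h : {perm T} -> R) :
  (forall s t : {perm T}, w (s ^ t)%g = w s) ->
  #|T|`!%:R * (\sum_s w s * h s) = \sum_s w s * \sum_(t : {perm T}) h (s ^ t)%g.
Proof.
move=> wJ; under [RHS]eq_bigr do rewrite mulr_sumr.
rewrite exchange_big /= [RHS](eq_bigr (fun=> \sum_s w s * h s)).
  by rewrite sumr_const card_permT mulr_natl.
move=> t _; rewrite [RHS](reindex_inj (conjg_inj t)).
by apply: eq_bigr => s _; rewrite wJ.
Qed.

Lemma weighted_markov (R : realFieldType) (X : finType) (h w : X -> R)
    (M be ga : R) :
  (forall x, h x <= M) -> 0 < M -> (forall x, 0 <= w x <= 1) ->
  0 <= be -> 0 <= ga ->
  be * M * (\sum_x w x) <= \sum_x w x * h x ->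
  (1 - ga) * be * (\sum_x w x) <= #|[set x | ga * be * M <= h x]|%:R.
Proof.
move=> hM M0 w01 be0 ga0 avg; rewrite -(ler_pM2l M0).
(* Pointwise: above the threshold [w x * h x] is at most [M], because [w x <= 1]; below it, at most
   [ga * be * M * w x]. *)
have : \sum_x w x * h x <=
    \sum_x (M * (ga * be * M <= h x)%R%:R + ga * be * M * w x).
  apply: ler_sum => x _; have /andP[w0 w1] := w01 x.
  have gbM : 0 <= ga * be * M by rewrite !mulr_ge0 // ltW.
  have wgb := mulr_ge0 gbM w0.
  case: (lerP (ga * be * M) (h x)) => [_|hx].
    rewrite mulr1; have := ler_wpM2l w0 (hM x); have := ler_wpM2r (ltW M0) w1.
    lra.
  by rewrite mulr0 add0r [leRHS]mulrC ler_wpM2l // ltW.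
rewrite big_split /= -!mulr_sumr -natr_sum.
have -> : (\sum_x (ga * be * M <= h x)%R)%N = #|[set x | ga * be * M <= h x]|.
  by rewrite -sum1dep_card [RHS]big_mkcond; apply: eq_bigr => x _; case: ifP.
move: avg; set W := \sum_x w x; set S := \sum_x _; set E := _%:R; lra.
Qed.

(** * Reweighting the permutations with a given number of fixed points *)

Lemma swapped_neq1 (T : finType) (s : {perm T}) : #|swapped s| != 1%N.
Proof.
apply/cards1P => -[x sx]; have : x \in swapped s by rewrite sx set11.
rewrite inE => /andP[sxx /eqP ssx].
have : s x \in swapped s by rewrite inE ssx eq_sym sxx eqxx.
by rewrite sx inE (negPf sxx).
Qed.

(* The mean of [#|swapped s|] is [1] over all permutations, and within
   [8/9, 9/8] over those with [j] fixed points; discounting the permutations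
   without swapped points, or those with some, moves the latter mean above [1],
   or below [5/6]. *)
Lemma fixn_weight (R : realFieldType) (T : finType) (j : nat) (e th : R) :
  (j + 5 <= #|T|)%N -> 0 <= th <= 1/6 ->
  exists2 w : {perm T} -> R,
    [/\ forall s, 0 <= w s <= 1, forall s t : {perm T}, w (s ^ t)%g = w s
      & forall s, fixn s != j -> w s = 0] &
    #|T|`!%:R / (5 * j`!%:R) <= \sum_s w s /\
    0 <= \sum_s w s * (e * (#|swapped s|%:R - (1 - th))).
Proof.
move=> jT /andP[th0 th1]; set m := (#|T| - j)%N.
have m5 : (5 <= m)%N by rewrite /m; lia.
pose eta (s : {perm T}) : R :=
  if 0 <= e then if (#|swapped s| == 0)%N then 3/4 else 1
  else if (#|swapped s| == 0)%N then 1 else 1/2.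
exists (fun s => if fixn s == j then eta s else 0).
  split=> [s|s t|s /negPf -> //]; last by rewrite /eta fixnJ swappedJ.
  by rewrite /eta; case: ifP => _; [case: ifP => _; case: ifP => _|]; lra.
(* All that matters about the layer is its size [N], the number [N0] of its members without swapped
   points, and the total [M] of swapped points; the linear bounds below, relative to [F], justify
   the weights 3/4 and 1/2. *)
pose N : R := #|[set s : {perm T} | fixn s == j]|%:R.
pose N0 : R := #|[set s : {perm T} | (fixn s == j) && (#|swapped s| == 0)%N]|%:R.
pose M : R := (\sum_(s : {perm T} | fixn s == j) #|swapped s|)%:R.
have sumN0 (a b c : R) : \sum_(s : {perm T}) (if fixn s == j then
    a + b * (#|swapped s| == 0)%N%:R + c * #|swapped s|%:R else 0)
    = a * N + b * N0 + c * M.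
  rewrite -big_mkcond !big_split /= -!mulr_sumr; congr (_ + _ * _ + _ * _).
  - by rewrite /N mulr_natr -sumr_const; apply: eq_bigl => s; rewrite inE.
  - rewrite -natr_sum /N0 -sum1dep_card; congr _%:R; rewrite [RHS]big_mkcondr.
    by apply: eq_bigr => s _; case: ifP.
  - by rewrite /M natr_sum.
set B := 'C(#|T|, j); pose F : R := (B * m`!)%:R.
have jT' : (j <= #|T|)%N by lia.
(* The derangement bounds are used on [m] points for [N] and on [m - 2] points for [M]; hence the
   margin of 5. *)
have [m3 m23] : (3 <= m)%N /\ (3 <= m - 2)%N by lia.
have FE : #|T|`!%:R = F * j`!%:R.
  by rewrite /F -natrM -(bin_fact jT') -[RHS]/((_ * _)%:R) -[in RHS]mulnA [in RHS](mulnC m`!).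
have Fj : #|T|`!%:R / (5 * j`!%:R) = F / 5.
  by rewrite FE; field; rewrite pnatr_eq0 -lt0n fact_gt0.
have [NF1 NF2] : F <= 3 * N /\ 8 * N <= 3 * F.
  have /andP[D1 D2] := subfactorial_bounds m3.
  rewrite /F /N card_fixn // -/m -/B -!natrM !ler_nat.
  by rewrite !(mulnCA _ B) !leq_mul2l D1 D2 !orbT.
have [MF1 MF2] : F <= 3 * M /\ 8 * M <= 3 * F.
  have /andP[D1 D2] := subfactorial_bounds m23.
  have mE : m`! = (m * (m - 1) * (m - 2)`!)%N.
    by case: (m) m3 => [|[|k]] // _; rewrite !factS mulnA !subSS !subn0.
  rewrite /F /M sum_fixn_swapped // -/m -/B -!natrM !ler_nat mE.
  by rewrite !(mulnCA _ B) !(mulnCA _ (m * (m - 1))%N) !leq_mul2l D1 D2 !orbT.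
have N0_ge0 : 0 <= N0 by [].
have N0N : N0 <= N.
  by rewrite ler_nat; apply: subset_leq_card; apply/subsetP => s; rewrite !inE => /andP[].
(* A nonzero number of swapped points is at least 2, so a small [M] forces a large [N0]. *)
have MN0 : 2 * (N - N0) <= M.
  have -> : 2 * (N - N0) = 2 * N + -2 * N0 + 0 * M by ring.
  rewrite -sumN0 /M natr_sum [leRHS]big_mkcond; apply: ler_sum => s _.
  case: ifP => // _; have := swapped_neq1 s.
  case: #|swapped s| => [|[|r]] // _; rewrite /= -?natr1 ?mulr0n; first lra.
  by have := ler0n R r; lra.
have sum_eta (a b u v z : R) :
    (forall s : {perm T}, eta s * (u * #|swapped s|%:R + v) =
       a + b * (#|swapped s| == 0)%N%:R + z * #|swapped s|%:R) ->
  \sum_(s : {perm T}) (if fixn s == j then eta s else 0) * (u * #|swapped s|%:R + v)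
    = a * N + b * N0 + z * M.
  move=> etaE; rewrite -sumN0; apply: eq_bigr => s _.
  by case: ifP => _; rewrite ?etaE ?mul0r.
have massE : \sum_(s : {perm T}) (if fixn s == j then eta s else 0) =
    \sum_(s : {perm T}) (if fixn s == j then eta s else 0) * (0 * #|swapped s|%:R + 1).
  by apply: eq_bigr => s _; ring.
have avgE : \sum_(s : {perm T}) (if fixn s == j then eta s else 0)
      * (e * (#|swapped s|%:R - (1 - th)))
    = e * (\sum_(s : {perm T}) (if fixn s == j then eta s else 0)
      * (1 * #|swapped s|%:R + (th - 1))).
  by rewrite mulr_sumr; apply: eq_bigr => s _; ring.
rewrite Fj massE avgE; rewrite /eta in sum_eta *; have [e0|e0] := boolP (0 <= e).
  rewrite e0 in sum_eta *.
  rewrite (sum_eta 1 (-(1/4)) 0 1 0); last first.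
    by move=> s; case: (_ == 0)%N => /=; lra.
  rewrite (sum_eta (th - 1) (-(1/4) * (th - 1)) 1 (th - 1) 1); last first.
    by move=> s; have [->|_] /= := eqVneq #|swapped s| 0%N; lra.
  split; first by lra.
  (* Isolating the products with [th] leaves an inequality linear in [N], [N0], [M] and [F]. *)
  apply: mulr_ge0 => //; have : 0 <= th * (N - 1/4 * N0) by apply: mulr_ge0; lra.
  lra.
rewrite (negPf e0) in sum_eta *; rewrite -ltNge in e0.
rewrite (sum_eta (1/2) (1/2) 0 1 0); last first.
  by move=> s; case: (_ == 0)%N => /=; lra.
rewrite (sum_eta (1/2 * (th - 1)) (1/2 * (th - 1)) 1 (th - 1) (1/2)); last first.
  by move=> s; have [->|_] /= := eqVneq #|swapped s| 0%N; lra.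
split; first by lra.
apply: mulr_le0; first exact: ltW.
have : 0 <= (1/6 - th) * (N + N0) by apply: mulr_ge0; lra.
lra.
Qed.

(** * Properties of the constant [beta_nk] *)

Lemma beta_nk_bounds (R : realType) (n k : nat) :
  (3 <= k)%N -> (k + 5 <= n)%N -> 0 <= beta_nk R n k <= 1 / 6.
Proof.
move=> k3 kn; rewrite /beta_nk.
have k3R : 3 <= k%:R :> R by rewrite ler_nat.
have knR : k%:R + 5 <= n%:R :> R by rewrite -natrD ler_nat.
(* Since [n - k >= 5] and [n >= k - 2], the denominator is at least [6 * (k - 2)]. *)
have D : 5 * (k%:R - 2) <= n%:R ^+ 2 - n%:R * k%:R :> R by nra.
apply/andP; split; first by apply: divr_ge0; lra.
by rewrite ler_pdivrMr; lra.
Qed.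

(* Under the uniform measure the function [p * (p - k)] of the number [p] of
   fixed points has mean [2 - k]; this is the resulting interpolation inequality
   at the nodes [0], [k] and [n]. *)
Lemma beta_nk_interpolation (R : realType) (n k : nat) (b d : R) :
  (3 <= k)%N -> (k + 5 <= n)%N ->
  let q (p : R) := b * (p - 1) + d * (p ^+ 2 - 2) in
  beta_nk R n k * q n%:R <= q 0 \/ beta_nk R n k * q n%:R <= q k%:R.
Proof.
move=> k3 kn q; rewrite /beta_nk.
have k3R : 3 <= k%:R :> R by rewrite ler_nat.
have knR : k%:R + 5 <= n%:R :> R by rewrite -natrD ler_nat.
move: (k%:R : R) (n%:R : R) k3R knR => K N K3 NK.
set D := N ^+ 2 - N * K + K - 2.
have D0 : 0 < D by rewrite /D; nra.
have bound u v : (K - 2) / D * u <= v = ((K - 2) * u <= v * D).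
  by rewrite mulrAC ler_pdivrMr.
rewrite !bound.
have [?|H0] := lerP ((K - 2) * q N) (q 0 * D); first by left.
have [?|Hk] := lerP ((K - 2) * q N) (q K * D); first by right.
(* These positive multipliers make the combination of the values at [0] and [K] equal to that at [N]
   for all [b] and [d]. The two resulting linear equations have a nonzero solution only for this
   value of beta. If both alternatives failed, the combination would be strictly below itself. *)
have c0 : 0 < (N - K) * ((K - 1) * (N - 1) + 1) by apply: mulr_gt0; nra.
have ck : 0 < N * (N - 2) by nra.
have : (N - K) * ((K - 1) * (N - 1) + 1) * (q 0 * D) + N * (N - 2) * (q K * D)
   < (N - K) * ((K - 1) * (N - 1) + 1) * ((K - 2) * q N) + N * (N - 2) * ((K - 2) * q N).
  by apply: ltrD; rewrite ltr_pM2l.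
have -> : (N - K) * ((K - 1) * (N - 1) + 1) * (q 0 * D) + N * (N - 2) * (q K * D)
   = (N - K) * ((K - 1) * (N - 1) + 1) * ((K - 2) * q N) + N * (N - 2) * ((K - 2) * q N).
  by rewrite /q /D; ring.
by rewrite ltxx.
Qed.

(** * Translation to a maximum at the identity, and the conclusion *)

Lemma gen_qap_lmul (R : realType) (n : nat) (f : 'S_n -> R) (t : 'S_n) :
  is_gen_qap f -> is_gen_qap (fun s => f (t * s)%g).
Proof.
case=> c fE; exists (fun i j => c (t^-1%g i) (t^-1%g j)) => s.
rewrite fE /gen_qap_objective [RHS](reindex_inj (@perm_inj _ t)).
apply: eq_bigr => i _; rewrite [RHS](reindex_inj (@perm_inj _ t)).
by apply: eq_bigr => j _; rewrite !permM !permK.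
Qed.

Lemma centered_lmul (R : realType) (n : nat) (f : 'S_n -> R) (t s : 'S_n) :
  centered (fun s => f (t * s)%g) s = centered f (t * s)%g.
Proof. by rewrite /centered /perm_mean [in RHS](reindex_inj (mulgI t)). Qed.

Lemma is_gen_qap_qap (R : realType) (n : nat) (f : 'S_n -> R) :
  is_qap f -> is_gen_qap f.
Proof. by case=> A [B fE]; exists (fun i j k l => B k l * A i j). Qed.

Lemma sum_centered (R : realType) (n : nat) (f : 'S_n -> R) :
  \sum_s centered f s = 0.
Proof.
rewrite /centered sumrB sumr_const card_Sn /perm_mean -[_ *+ n`!]mulr_natl mulVKf ?subrr //.
by rewrite pnatr_eq0 -lt0n fact_gt0.
Qed.

Lemma gen_qap_tail_identity (R : realType) (n k : nat) (h : 'S_n -> R) (gamma : R) :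
  is_gen_qap h -> (forall s, centered h s <= centered h 1%g) ->
  (3 <= k)%N -> (k + 5 <= n)%N -> 0 < gamma -> gamma < 1 ->
  (1 - gamma) * beta_nk R n k / (5 * k`!%:R) <=
  unif_prob R [set s | gamma * beta_nk R n k * centered h 1%g <= centered h s].
Proof.
move=> [c hE] hmax k3 kn g0 g1.
have /andP[be0 be1] := beta_nk_bounds R k3 kn.
set be := beta_nk R n k in be0 be1 *; set M := centered h 1%g.
rewrite /unif_prob card_Sn.
have F0 : 0 < n`!%:R :> R by rewrite ltr0n fact_gt0.
rewrite ler_pdivlMr //.
have k1 : 1 <= k`!%:R :> R by rewrite ler1n fact_gt0.
have M_ge0 : 0 <= M.
  have : \sum_s centered h s <= \sum_(s : 'S_n) M by apply: ler_sum.
  by rewrite sum_centered sumr_const card_Sn pmulrn_lge0 // fact_gt0.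
(* If the maximum of a function of mean zero is 0, the function vanishes and the event is the whole
   group. *)
have [M0|M_neq0] := eqVneq M 0.
  have h0 s : centered h s = 0.
    have /psumr_eq0P : forall s, true -> 0 <= M - centered h s by move=> t _; rewrite subr_ge0.
    rewrite sumrB sum_centered M0 big1_eq subr0 => /(_ erefl s isT).
    by rewrite sub0r => /eqP; rewrite oppr_eq0 => /eqP.
  rewrite (_ : [set s | _] = setT); last by apply/setP => s; rewrite !inE h0 M0 mulr0 lexx.
  rewrite cardsT card_Sn; apply: ler_piMl; first exact: ltW.
  by rewrite ler_pdivrMr; nra.
have M_gt0 : 0 < M by rewrite lt_def M_neq0.
have T3 : (3 < #|'I_n|)%N by rewrite card_ord; lia.
have [a [b [d [e abde]]]] := quadratic_conj_average c T3.
have conj_h s : \sum_(t : 'S_n) h (s ^ t)%g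
    = a + b * (fixn s)%:R + d * (fixn s)%:R ^+ 2 + e * #|swapped s|%:R.
  by rewrite -abde; apply: eq_bigr => t _; rewrite hE.
set mu := perm_mean h.
have muE : n`!%:R * mu = a + b + 2 * d + e.
  apply: (mulfI (lt0r_neq0 F0)).
  have := @class_weighted_sum R _ (fun=> 1) h (fun _ _ => erefl).
  rewrite card_ord; under eq_bigr do rewrite mul1r.
  rewrite [n`!%:R * mu]mulVKf ?(lt0r_neq0 F0) // => ->.
  under eq_bigr do rewrite mul1r conj_h.
  have T1 : (1 < #|'I_n|)%N by lia.
  rewrite !big_split /= -!mulr_sumr -!natr_sum sum_fixn // sum_swapped //.
  have -> : \sum_(s : 'S_n) (fixn s)%:R ^+ 2 = 2 * n`!%:R :> R.
    under eq_bigr do rewrite -natrX.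
    by rewrite -natr_sum sum_fixn_sqr // card_ord natrM.
  by rewrite sumr_const card_Sn -[a *+ _]mulr_natr card_ord; ring.
(* The identity is its own only conjugate, with [n] fixed points and no swapped point; centring the
   term in [e] leaves [- e]. *)
have ME : n`!%:R * M = b * (n%:R - 1) + d * (n%:R ^+ 2 - 2) - e.
  have : n`!%:R * h 1%g = a + b * n%:R + d * n%:R ^+ 2.
    rewrite mulr_natl -card_Sn -sumr_const.
    rewrite (eq_bigr (fun t => h (1 ^ t)%g)) => [|t _]; last by rewrite conj1g.
    by rewrite conj_h fixn1 swapped1 card_ord mulr0 addr0.
  by rewrite /M /centered mulrBr muE => ->; ring.
pose q (p : R) := b * (p - 1) + d * (p ^+ 2 - 2).
(* Either layer suffices: for [j <= k] the mass bound with [j] implies the one with [k]. *)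
have concl (j : nat) : (j <= k)%N -> be * q n%:R <= q j%:R ->
    (1 - gamma) * be / (5 * k`!%:R) * n`!%:R <=
    #|[set s : 'S_n | gamma * be * M <= centered h s]|%:R.
  move=> jk qj.
  have jT : (j + 5 <= #|'I_n|)%N by rewrite card_ord; lia.
  have th01 : 0 <= be <= 1/6 by rewrite be0 be1.
  have [w [w01 wJ w_supp] [w_mass w_avg]] := fixn_weight e jT th01.
  rewrite card_ord in w_mass.
  have mass : n`!%:R / (5 * k`!%:R) <= \sum_s w s.
    apply: le_trans w_mass; rewrite ler_pM2l // lef_pV2 ?posrE.
    - by rewrite ler_pM2l // ler_nat; apply: leq_fact.
    - by rewrite mulr_gt0 // ltr0n fact_gt0.
    - by rewrite mulr_gt0 // ltr0n fact_gt0.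
  apply: (@le_trans _ _ ((1 - gamma) * be * \sum_s w s)).
    by rewrite -[leLHS]mulrA (mulrC _ n`!%:R) ler_wpM2l // mulr_ge0 //; lra.
  apply: weighted_markov => //; first exact: ltW.
  rewrite -(ler_pM2l F0).
  (* On the layer the centred conjugation sum is [q j + e * (r - 1)]. Moving [be * e] between the
     two terms matches the [- e] in [M], which is why the weights are built with [th = be]. *)
  have -> : n`!%:R * (\sum_s w s * centered h s)
      = (q j%:R - be * e) * (\sum_s w s)
      + \sum_s w s * (e * (#|swapped s|%:R - (1 - be))).
    under eq_bigr do rewrite mulrBr.
    rewrite sumrB mulrBr -mulr_suml [X in X - _](_ : _ =
      \sum_s w s * \sum_(t : 'S_n) h (s ^ t)%g); last first.
      by rewrite -class_weighted_sum // card_ord.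
    rewrite mulrCA muE mulr_suml mulr_sumr -sumrB -big_split; apply: eq_bigr => s _ /=.
    rewrite conj_h /q; have [->|/w_supp ->] := eqVneq (fixn s) j; ring.
  have -> : n`!%:R * (be * M * \sum_s w s) = be * (q n%:R - e) * \sum_s w s.
    by rewrite /q -ME; ring.
  have W0 : 0 <= \sum_s w s by apply: sumr_ge0 => s _; case/andP: (w01 s).
  have := ler_wpM2r W0 qj; lra.
have [q0|qk] := beta_nk_interpolation b d k3 kn.
  exact: (concl 0%N).
exact: (concl k).
Qed.

Theorem theorem5p1 (R : realType) (n k : nat) (f : 'S_n -> R) (tau : 'S_n)
    (gamma : R)
    (hf : is_qap f \/ is_gen_qap f)
    (htau : forall sigma : 'S_n, centered f sigma <= centered f tau)
    (hk3 : (3 <= k)%N) (hkn : (k + 5 <= n)%N)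
    (hgamma0 : 0 < gamma) (hgamma1 : gamma < 1) :
  (1 - gamma) * beta_nk R n k / (5 * k`!%:R) <=
  unif_prob R [set sigma : 'S_n |
    gamma * beta_nk R n k * centered f tau <= centered f sigma].
Proof.
have hg : is_gen_qap f by case: hf => // /is_gen_qap_qap.
pose h s := f (tau * s)%g.
have h1 : centered h 1%g = centered f tau by rewrite centered_lmul mulg1.
have hmax s : centered h s <= centered h 1%g by rewrite h1 centered_lmul.
have := gen_qap_tail_identity (gen_qap_lmul tau hg) hmax hk3 hkn hgamma0 hgamma1.
congr (_ <= _); rewrite /unif_prob; congr (_%:R / _).
rewrite -[RHS](card_preimset _ (@mulgI _ tau)); apply: eq_card => s.
by rewrite !inE h1 centered_lmul.
Qed.
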